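(* Let $A\in\mathbb{R}^{n\times m}$, $\eta>0$ and $T\in\mathbb{N}$. Let $x^*\in\Delta(\mathcal{A})$ be an optimal constant strategy for the continuous-time zero-sum game against the Replicator Dynamics, i.e. a maximizer over $x\in\Delta(\mathcal{A})$ of $\frac1\eta\left(\ln m-\ln\sum_{i=1}^m e^{-\eta T e_i^\top A^\top x}\right)$. Then the optimizer that plays $x(t)=x^*$ in every round $t=1,\dots,T$ of the discrete-time zero-sum game against a learner using MWU with step size $\eta$ obtains total utility at least $R^*_{cont}(\mathbf{0},T,A,-A)$. Consequently, $$R^*_{disc}(\mathbf{0},T,A,-A)\ \ge\ R^*_{cont}(\mathbf{0},T,A,-A).$$
   Context: $\Delta(\mathcal{A})\subset\mathbb{R}^n$ is the optimizer's probability simplex; $e_1,\dots,e_m$ is the standard basis of $\mathbb{R}^m$; $A$ is the optimizer's utility matrix and $-A$ the learner's. Continuous time: a strategy of the optimizer is a (measurable) function $x:[0,T]\to\Delta(\mathcal{A})$; the learner using the Replicator Dynamics plays $y_i(t)=\exp(-\eta\, e_i^\top A^\top\int_0^t x(s)ds)\big/\sum_{j=1}^m\exp(-\eta\, e_j^\top A^\top\int_0^t x(s)ds)$; $R^*_{cont}(\mathbf{0},T,A,-A)$ is the maximum over $x$ of $\int_0^T x(t)^\top A\,y(t)\,dt$. Discrete time: a strategy of the optimizer is a sequence $x(1),\dots,x(T)\in\Delta(\mathcal{A})$; the learner using MWU (Multiplicative Weights Update) with step size $\eta$ plays in round $t$ the mixed strategy $y_i(t)=\exp(-\eta\, e_i^\top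 A^\top\sum_{s=1}^{t-1}x(s))\big/\sum_{j=1}^m\exp(-\eta\, e_j^\top A^\top\sum_{s=1}^{t-1}x(s))$; the optimizer's total utility is $\sum_{t=1}^T x(t)^\top A\,y(t)$, and $R^*_{disc}(\mathbf{0},T,A,-A)$ is its maximum over all such sequences. *)

(* Defs.v *)
From HB Require Import structures.
From mathcomp Require Import all_boot all_order all_algebra.
From mathcomp Require Import all_classical all_reals all_analysis.

Set Implicit Arguments.
Unset Strict Implicit.
Unset Printing Implicit Defensive.

Import Order.TTheory GRing.Theory Num.Theory.
Import numFieldNormedType.Exports.

Local Open Scope classical_set_scope.
Local Open Scope ring_scope.

Definition simplex (R : realType) (n : nat) : set 'cV[R]_n :=
  [set x | (forall i, 0 <= x i 0) /\ \sum_(i < n) x i 0 = 1].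

Definition is_maximum (R : realType) (S : set R) (v : R) : Prop :=
  S v /\ ubound S v.

Definition payoff (R : realType) (n m : nat) (A : 'M[R]_(n, m))
    (x : 'cV[R]_n) (y : 'cV[R]_m) : R :=
  (x^T *m A *m y) 0 0.

(* Learner's mixed strategy when X is the optimizer's cumulative past play
   (an integral or a sum) and the learner's utility matrix is - A:
   (A^T *m X) i 0 is e_i^T A^T X. *)
Definition exp_weights (R : realType) (n m : nat) (A : 'M[R]_(n, m)) (eta : R)
    (X : 'cV[R]_n) : 'cV[R]_m :=
  \col_i (expR (- eta * (A^T *m X) i 0) /
          \sum_(j < m) expR (- eta * (A^T *m X) j 0)).

Section Continuous.
Variables (R : realType) (n m : nat) (A : 'M[R]_(n, m)) (eta T : R).

(* Values outside [0, T] are irrelevant. *)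
Definition cont_strategy : set (R -> 'cV[R]_n) :=
  [set x : R -> 'cV[R]_n |
     (forall i : 'I_n, measurable_fun `[0, T] (fun t : R => x t i 0)) /\
     (forall t : R, 0 <= t <= T -> simplex (x t))].

Definition replicator (x : R -> 'cV[R]_n) (t : R) : 'cV[R]_m :=
  exp_weights A eta
    (\col_i Rintegral lebesgue_measure `[0, t] (fun s : R => x s i 0)).

Definition cont_utility (x : R -> 'cV[R]_n) : R :=
  Rintegral lebesgue_measure `[0, T]
    (fun t : R => payoff A (x t) (replicator x t)).

Definition is_R_cont (v : R) : Prop :=
  is_maximum (cont_utility @` cont_strategy) v.

Definition const_objective (x : 'cV[R]_n) : R :=
  eta^-1 * (ln m%:R - ln (\sum_(i < m) expR (- eta * T * (A^T *m x) i 0))).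

Definition optimal_const (xstar : 'cV[R]_n) : Prop :=
  simplex xstar /\
  forall x, simplex x -> const_objective x <= const_objective xstar.

End Continuous.

Section Discrete.
Variables (R : realType) (n m : nat) (A : 'M[R]_(n, m)) (eta : R) (T : nat).

(* Rounds are numbered 1, ..., T; values at other indices are irrelevant. *)
Definition disc_strategy : set (nat -> 'cV[R]_n) :=
  [set x | forall t, (1 <= t <= T)%N -> simplex (x t)].

Definition mwu (x : nat -> 'cV[R]_n) (t : nat) : 'cV[R]_m :=
  exp_weights A eta (\sum_(1 <= s < t) x s).

Definition disc_utility (x : nat -> 'cV[R]_n) : R :=
  \sum_(1 <= t < T.+1) payoff A (x t) (mwu x t).

Definition is_R_disc (v : R) : Prop :=
  is_maximum (disc_utility @` disc_strategy) v.

End Discrete.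

(* Main.v *)
Require Import Defs.
From HB Require Import structures.
From mathcomp Require Import all_boot all_order all_algebra.
From mathcomp Require Import all_classical all_reals all_analysis.
From mathcomp Require Import measurable_realfun ring lra.

(** Write [L X = (ln m - ln (sum_i exp (- eta (A^T X)_i))) / eta] and let [y X]
    be the exponential-weights response to the cumulative play [X].  Jensen's
    inequality gives [L (X + h) - L X <= h^T A y X].  In discrete time this
    telescopes: a constant [x] earns at least [L (T x)].  In continuous time,
    applying it from both ends of [[s, t]] squeezes [L (X t) - L (X s)] between
    the payoffs of [X t - X s] against [y (X t)] and against [y (X s)]; both
    differ from the utility earned on [[s, t]] by O((t - s)^2) because
    [y (X r)] is Lipschitz in [r].  Hence the total utility of any measurable
    strategy is exactly [L (X T)], and [X T / T] lies in the simplex, so the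
    continuous optimum is the maximum of [x |-> L (T x)]. *)

Import Order.TTheory GRing.Theory Num.Theory.
Import numFieldNormedType.Exports.

Local Open Scope classical_set_scope.
Local Open Scope ring_scope.

Set Implicit Arguments.
Unset Strict Implicit.
Unset Printing Implicit Defensive.

(** * The log-sum-exp potential and the exponential-weights response *)

Section Potential.
Variables (R : realType) (n m : nat) (A : 'M[R]_(n, m)) (eta : R).

Lemma mulmx_entryD (M : 'M[R]_(m, n)) (X h : 'cV[R]_n) j :
  (M *m (X + h)) j 0 = (M *m X) j 0 + (M *m h) j 0.
Proof. by rewrite mulmxDr mxE. Qed.

Lemma mulmx_entryB (M : 'M[R]_(m, n)) (X h : 'cV[R]_n) j :
  (M *m (X - h)) j 0 = (M *m X) j 0 - (M *m h) j 0.
Proof. by rewrite mulmx_entryD mulmxN [X in _ + X]mxE. Qed.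

Lemma payoffE (x : 'cV[R]_n) (y : 'cV[R]_m) :
  payoff A x y = \sum_j (A^T *m x) j 0 * y j 0.
Proof.
rewrite /payoff -[x^T *m A]trmxK trmx_mul trmxK !mxE.
by apply: eq_bigr => j _; rewrite !mxE.
Qed.

Lemma payoff_sumE (x : 'cV[R]_n) (y : 'cV[R]_m) :
  payoff A x y = \sum_j \sum_i x i 0 * A i j * y j 0.
Proof.
rewrite payoffE; apply: eq_bigr => j _; rewrite mxE mulr_suml.
by apply: eq_bigr => i _; rewrite mxE (mulrC (A i j)).
Qed.

Lemma payoff_linearE (x : 'cV[R]_n) (y : 'cV[R]_m) :
  payoff A x y = \sum_i x i 0 * (A *m y) i 0.
Proof. by rewrite /payoff -mulmxA mxE; apply: eq_bigr => i _; rewrite mxE. Qed.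

Lemma payoffNl (x : 'cV[R]_n) (y : 'cV[R]_m) : payoff A (- x) y = - payoff A x y.
Proof. by rewrite /payoff linearN/= !mulNmx mxE. Qed.

Lemma payoffBr (x : 'cV[R]_n) (y z : 'cV[R]_m) :
  payoff A x (y - z) = payoff A x y - payoff A x z.
Proof. by rewrite /payoff mulmxBr mxE [X in _ + X]mxE. Qed.

Definition partition_fun (X : 'cV[R]_n) : R :=
  \sum_(j < m) expR (- eta * (A^T *m X) j 0).

(** A soft minimum of the entries of [A^T *m X]; the term [ln m%:R] normalises it to vanish at
    [X = 0]. *)
Definition potential (X : 'cV[R]_n) : R :=
  eta^-1 * (ln m%:R - ln (partition_fun X)).

Lemma partition_fun_gt0 X : (0 < m)%N -> 0 < partition_fun X.
Proof.
move=> m0; rewrite /partition_fun (bigD1 (Ordinal m0)) //=.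
by rewrite ltr_pwDl ?expR_gt0// sumr_ge0// => i _; rewrite expR_ge0.
Qed.

Lemma exp_weightsE X j : exp_weights A eta X j 0 =
  expR (- eta * (A^T *m X) j 0) / partition_fun X.
Proof. by rewrite mxE. Qed.

Lemma exp_weights_ge0 X j : 0 <= exp_weights A eta X j 0.
Proof. by rewrite mxE divr_ge0 ?expR_ge0// sumr_ge0// => i _; rewrite expR_ge0. Qed.

Lemma exp_weights_le1 X j : exp_weights A eta X j 0 <= 1.
Proof.
have W0 := partition_fun_gt0 X (leq_ltn_trans (leq0n j) (ltn_ord j)).
rewrite mxE ler_pdivrMr// mul1r (bigD1 j)//= lerDl.
by rewrite sumr_ge0// => i _; rewrite expR_ge0.
Qed.

(* Jensen's inequality for exp, obtained from [1 + u <= exp u] at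
   [u = - eta (b_j - bbar)] where [b = A^T h] and
   [bbar] is its average under the exponential weights. *)
Lemma potential_step X h : 0 < eta ->
  potential (X + h) - potential X <= payoff A h (exp_weights A eta X).
Proof.
(* Positivity of the partition function needs [0 < m]; for [m = 0] all sums are empty and both sides
   are 0. *)
move=> eta0; have [m0|m0] := posnP m.
  rewrite /potential payoffE /partition_fun.
  by subst m; rewrite !big_ord0 subrr.
have W0 := partition_fun_gt0 X m0; have W'0 := partition_fun_gt0 (X + h) m0.
rewrite /potential -mulrBr mulrC ler_pdivrMr//.
rewrite [leLHS](_ : _ = ln (partition_fun X) - ln (partition_fun (X + h))); last by ring.
set b := payoff _ _ _.
suff : ln (partition_fun X * expR (- eta * b)) <= ln (partition_fun (X + h)).
  by rewrite lnM ?posrE ?expR_gt0// expRK; lra.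
rewrite ler_ln ?posrE ?mulr_gt0 ?expR_gt0//.
have Wb : partition_fun X * b =
    \sum_j expR (- eta * (A^T *m X) j 0) * (A^T *m h) j 0.
  rewrite /b payoffE mulr_sumr; apply: eq_bigr => j _.
  by rewrite exp_weightsE; field; rewrite gt_eqF.
apply: (@le_trans _ _ (\sum_j expR (- eta * b) * (expR (- eta * (A^T *m X) j 0) *
   (1 + - eta * ((A^T *m h) j 0 - b))))).
  rewrite -mulr_sumr mulrC ler_pM2l ?expR_gt0//.
  under eq_bigr do rewrite mulrDr mulr1 mulrCA mulrBr.
  by rewrite big_split/= -mulr_sumr sumrB -Wb -mulr_suml subrr mulr0 addr0.
apply: ler_sum => j _.
have -> : - eta * (A^T *m (X + h)) j 0 =
    - eta * (A^T *m X) j 0 + (- eta * b + - eta * ((A^T *m h) j 0 - b)).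
  by rewrite mulmx_entryD; ring.
rewrite expRD mulrCA ler_pM2l ?expR_gt0// expRD ler_pM2l ?expR_gt0//.
exact: expR_ge1Dx.
Qed.

Lemma potential0 : potential 0 = 0.
Proof.
rewrite /potential /partition_fun mulmx0.
under eq_bigr do rewrite mxE mulr0 expR0.
by rewrite sumr_const card_ord subrr mulr0.
Qed.

Lemma const_objectiveE (T : R) x :
  const_objective A eta T x = potential (T *: x).
Proof.
rewrite /const_objective /potential /partition_fun; congr (_ * (_ - ln _)).
by apply: eq_bigr => i _; rewrite -scalemxAr [in RHS]mxE mulrA.
Qed.

Lemma disc_utility_const_ge (T : nat) x : 0 < eta ->
  const_objective A eta T%:R x <= disc_utility A eta T (fun=> x).
Proof.
move=> eta0; rewrite const_objectiveE /disc_utility /mwu big_add1 /=.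
(* After the shift, index [t] stands for round [t + 1], where the learner has seen exactly [t]
   copies of [x]. *)
rewrite (eq_big_nat _ _ (F2 := fun t => payoff A x (exp_weights A eta (t%:R *: x)))).
  elim: T => [|T IH]; first by rewrite big_geq// scale0r potential0.
  rewrite big_nat_recr//= -natr1 scalerDl scale1r.
  have := potential_step (T%:R *: x) x eta0; lra.
by move=> t _; rewrite sumr_const_nat subn1 scaler_nat.
Qed.

(** Passing from [X] to [X'] changes each numerator and the partition function by factors between
    exp(- eta d) and exp(eta d), so a weight shrinks at most by the factor exp(- 2 eta d) >= 1 - 2
    eta d. Since weights are at most 1, the loss is at most 2 eta d. Exchanging [X] and [X'] gives
    the two-sided bound. *)
Lemma exp_weights_lip X X' (d : R) : 0 <= eta ->
    (forall j, `|(A^T *m (X' - X)) j 0| <= d) ->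
  forall j, exp_weights A eta X j 0 - exp_weights A eta X' j 0 <= 2 * eta * d.
Proof.
move=> eta0 hd j.
have W0 X1 := partition_fun_gt0 X1 (leq_ltn_trans (leq0n j) (ltn_ord j)).
pose u := eta * d.
have hE i : - u <= - eta * (A^T *m (X' - X)) i 0 <= u.
  by rewrite -ler_norml normrM normrN (ger0_norm eta0) /u ler_wpM2l.
have eE i : - eta * (A^T *m X') i 0 =
    - eta * (A^T *m X) i 0 + - eta * (A^T *m (X' - X)) i 0.
  by rewrite mulmx_entryB; ring.
have wj : expR (- u) * expR (- eta * (A^T *m X) j 0) <= expR (- eta * (A^T *m X') j 0).
  by rewrite -expRD ler_expR eE; have := hE j; lra.
have wW : partition_fun X' <= expR u * partition_fun X.
  rewrite /partition_fun mulr_sumr; apply: ler_sum => i _.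
  by rewrite -expRD ler_expR eE; have := hE i; lra.
have key : expR (- (2 * u)) * exp_weights A eta X j 0 <= exp_weights A eta X' j 0.
  rewrite !exp_weightsE.
  rewrite ler_pdivlMr// mulrA mulrAC ler_pdivrMr//.
  apply: le_trans (ler_wpM2r (ltW (W0 X)) wj).
  have c0 : 0 <= expR (- (2 * u)) * expR (- eta * (A^T *m X) j 0).
    by rewrite mulr_ge0 ?expR_ge0.
  apply: le_trans (ler_wpM2l c0 wW) _.
  have -> : expR (- u) = expR (- (2 * u)) * expR u by rewrite -expRD; congr expR; ring.
  by rewrite le_eqVlt; apply/orP; left; apply/eqP; ring.
have e1 := expR_ge1Dx (- (2 * u)).
have p0 := exp_weights_ge0 X j; have p1 := exp_weights_le1 X j.
have d0 : 0 <= d by apply: le_trans (hd j).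
have u0 : 0 <= u by rewrite mulr_ge0.
rewrite -mulrA -/u; nra.
Qed.

End Potential.

(** * Integrals of finite sums, and functions with quadratic increments *)

Lemma Rintegral_sum d (T : measurableType d) (R : realType)
    (mu : {measure set T -> \bar R}) (D : set T) (I : Type) (s : seq I)
    (f : I -> T -> R) : measurable D ->
  (forall i, mu.-integrable D (EFin \o f i)) ->
  Rintegral mu D (fun x => \sum_(i <- s) f i x) = \sum_(i <- s) Rintegral mu D (f i).
Proof.
move=> mD fi; have fs s' : mu.-integrable D (EFin \o (fun x => \sum_(i <- s') f i x)).
  rewrite (_ : _ \o _ = (fun x => \sum_(i <- s') (EFin \o f i) x)%E).
    by apply: integrable_sum.
  by apply: funext => x; rewrite /= sumEFin.
elim: s => [|i s IH].
  under eq_Rintegral do rewrite big_nil.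
  by rewrite big_nil Rintegral_cst// mul0r.
under eq_Rintegral do rewrite big_cons.
by rewrite RintegralD// IH big_cons.
Qed.

Section QuadraticIncrements.
Variables (R : realType) (G : R -> R) (K T : R).

(** Cutting [[0, T]] into N + 1 equal pieces bounds the total change by K T^2 / (N + 1), which tends
    to 0. This replaces a differentiation argument, which for merely measurable strategies would
    hold only almost everywhere. *)
Lemma quadratic_increments_constant : 0 <= T ->
  (forall s t, 0 <= s -> s <= t -> t <= T -> `|G t - G s| <= K * (t - s) ^+ 2) ->
  G T = G 0.
Proof.
move=> T0 hG.
have step N k : (k <= N.+1)%N ->
    `|G (k%:R * (T / N.+1%:R)) - G 0| <= k%:R * (K * (T / N.+1%:R) ^+ 2).
  have d0 : 0 <= T / N.+1%:R by rewrite divr_ge0.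
  elim: k => [|k IH] kN; first by rewrite !mul0r subrr normr0.
  set a := k.+1%:R * _; set b := k%:R * (T / _) in IH *.
  have ab : a - b = T / N.+1%:R by rewrite /a /b -natr1; ring.
  have aT : a <= T by rewrite /a mulrCA ler_piMr// ler_pdivrMr// mul1r ler_nat.
  have b0 : 0 <= b by rewrite /b mulr_ge0.
  have ba : b <= a by rewrite -subr_ge0 ab.
  have := hG _ _ b0 ba aT; rewrite ab => h2.
  have := ler_normD (G a - G b) (G b - G 0); rewrite subrKA => h3.
  apply: (le_trans h3); rewrite -[in leRHS]natr1 mulrDl mul1r addrC.
  by rewrite lerD// IH// ltnW.
apply/eqP; rewrite -subr_eq0 -normr_le0; apply/ler_addgt0Pr => e e0.
(* This [N] makes K T^2 / (N + 1) at most [e]; the absolute value is there because the sign of [K]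
   is unknown. *)
rewrite add0r; pose N := Num.bound (`|K| * T ^+ 2 / e).
have N0 : 0 < N.+1%:R :> R by rewrite ltr0n.
have := step N N.+1 (leqnn _); rewrite mulrCA mulfV ?gt_eqF// mulr1 => /le_trans; apply.
have : `|K| * T ^+ 2 / e < N.+1%:R.
  rewrite (lt_le_trans (archi_boundP _))// ?ler_nat//.
  by rewrite divr_ge0 ?(ltW e0)// mulr_ge0// sqr_ge0.
rewrite ltr_pdivrMr// => /ltW h.
rewrite [leLHS](_ : _ = K * T ^+ 2 / N.+1%:R); last by field; rewrite gt_eqF.
rewrite ler_pdivrMr// [leRHS]mulrC; apply: le_trans h.
by rewrite ler_wpM2r ?sqr_ge0// ler_norm.
Qed.
End QuadraticIncrements.

(** * Continuity of matrix expressions and compactness of the space of plays *)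

Lemma continuous_sumr (T : topologicalType) (R : realType) (I : Type)
    (r : seq I) (P : pred I) (F : I -> T -> R) :
  (forall i, P i -> continuous (F i)) ->
  continuous (fun x => \sum_(i <- r | P i) F i x).
Proof. by move=> h; apply: continuous_big => //; exact: add_continuous. Qed.

Lemma mulmx_entry_continuous (T : topologicalType) (R : realType) (m n : nat)
    (M : 'M[R]_(m, n)) (X : T -> 'cV[R]_n) :
  (forall i, continuous (fun p => X p i 0)) ->
  forall j, continuous (fun p => (M *m X p) j 0).
Proof.
move=> hX j; under eq_fun do rewrite mxE.
by apply: continuous_sumr => i _ p; apply: continuousM; [exact: cvg_cst|exact: hX].
Qed.

Lemma expR_scale_continuous (T : topologicalType) (R : realType) (f : T -> R) (a : R) :
  continuous f -> continuous (fun p => expR (a * f p)).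
Proof.
move=> hf p; apply: (@continuous_comp _ _ _ (fun p => a * f p) expR);
  last exact: continuous_expR.
by apply: continuousM; [exact: cvg_cst|exact: hf].
Qed.

Section Compactness.
Variables (R : realType) (n : nat).

Lemma simplex_ge0_le1 (x : 'cV[R]_n) i : simplex x -> 0 <= x i 0 <= 1.
Proof.
move=> [x0 x1]; rewrite x0 -x1 (bigD1 i)//= lerDl.
by rewrite sumr_ge0.
Qed.

Lemma simplex_nonempty : (0 < n)%N -> exists x : 'cV[R]_n, simplex x.
Proof.
move=> n0; exists (delta_mx (Ordinal n0) 0); split=> [i|].
  by rewrite mxE ler0n.
rewrite (bigD1 (Ordinal n0))//= mxE !eqxx big1 ?addr0// => i /negbTE.
by rewrite mxE => ->.
Qed.

(** Round and coordinate are merged into one index, so that a single product of real lines carries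
    all plays and Tychonoff's theorem applies. *)
Definition sequence_space := prod_topology (fun _ : nat * 'I_n => (R : topologicalType)).

Lemma sequence_space_entry_continuous t i :
  continuous (fun f : sequence_space => (\col_k f (t, k)) i 0).
Proof.
have -> : (fun f : sequence_space => (\col_k f (t, k)) i 0) = (fun f => f (t, i)).
  by apply: funext => f; rewrite mxE.
exact: (@proj_continuous _ (fun=> R)).
Qed.

(** Sequences in the simplex form a closed subset of the cube of all [0, 1]-valued families, which
    is compact by Tychonoff; the extreme value theorem then applies. It serves both for whole
    discrete strategies and, by reading one round only, for single vectors. *)
Lemma simplex_sequences_max (F : (nat -> 'cV[R]_n) -> R) : (0 < n)%N ->
  continuous (fun f : sequence_space => F (fun t => \col_i f (t, i))) ->
  exists2 x, forall t, simplex (x t) &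
    forall x', (forall t, simplex (x' t)) -> F x' <= F x.
Proof.
move=> n0 Fc.
have pc ti : continuous (fun f : sequence_space => f ti) :=
  @proj_continuous _ (fun=> R) ti.
pose cube : set sequence_space := [set f | forall ti, `[0, 1]%classic (f ti)].
pose aff : set sequence_space := [set f | forall t, \sum_i f (t, i) = 1].
have cK : compact (cube `&` aff).
  apply: compact_closedI.
    by apply: (@tychonoff _ (fun=> R) (fun=> `[0, 1]%classic)) => _;
      exact: segment_compact.
  rewrite (_ : aff = \bigcap_t (fun f : sequence_space => \sum_i f (t, i)) @^-1` [set 1]).
    apply: closed_bigI => t _; apply: preimage_closed; last exact: closed_eq.
    by move=> f _; apply: continuous_sumr => i _; exact: pc.
  by apply/seteqP; split=> f /= hf => [t _|t]; exact: hf.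
have of_simplex (x : nat -> 'cV[R]_n) : (forall t, simplex (x t)) ->
    (cube `&` aff) (fun ti => x ti.1 ti.2 0).
  move=> xS; split=> [[t i]|t] /=; last by case: (xS t).
  by rewrite in_itv/= (simplex_ge0_le1 _ (xS t)).
have [x0 x0S] := simplex_nonempty n0.
have K0 : (cube `&` aff) !=set0 by eexists; exact: (of_simplex (fun=> x0)).
have [f /set_mem [fc fa] fmax] := compact_EVT_max K0 cK (continuous_subspaceT Fc).
exists (fun t => \col_i f (t, i)) => [t|x xS].
  split=> [i|]; first by rewrite mxE; have := fc (t, i); rewrite /= in_itv/= => /andP[].
  by rewrite -(fa t); apply: eq_bigr => i _; rewrite mxE.
have := fmax _ (mem_set (of_simplex x xS)).
by congr (F _ <= _); apply: funext => t; apply/colP => i; rewrite mxE.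
Qed.
End Compactness.

(** * Continuity of potential, response and payoff over any space, later a space of sequences or the
    subspace [[0, T]] *)

Section EntrywiseContinuity.
Variables (S : topologicalType) (R : realType) (n m : nat).
Variables (A : 'M[R]_(n, m)) (eta : R).
Variable X : S -> 'cV[R]_n.
Hypothesis X_continuous : forall i, continuous (fun p => X p i 0).

Lemma partition_fun_continuous : continuous (fun p => partition_fun A eta (X p)).
Proof.
apply: continuous_sumr => j _; apply: expR_scale_continuous.
exact: mulmx_entry_continuous.
Qed.

Lemma exp_weights_continuous j : continuous (fun p => exp_weights A eta (X p) j 0).
Proof.
under eq_fun do rewrite exp_weightsE.
move=> p; apply: (@continuousM _ _ (fun p => expR (- eta * (A^T *m X p) j 0))
  (fun p => (partition_fun A eta (X p))^-1)).
  by apply: expR_scale_continuous; exact: mulmx_entry_continuous.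
apply: continuousV; last exact: partition_fun_continuous.
by rewrite gt_eqF// partition_fun_gt0// (leq_ltn_trans (leq0n j)).
Qed.

Lemma potential_continuous : continuous (fun p => potential A eta (X p)).
Proof.
(* Continuity of [ln] is available only at positive arguments; for [m = 0] the potential is
   constant. *)
have [m0|m0] := posnP m.
  rewrite /potential /partition_fun; subst m.
  by under eq_fun do rewrite big_ord0; move=> p; exact: cvg_cst.
move=> p; apply: (@continuousM _ _ (fun=> eta^-1)
  (fun p => ln m%:R - ln (partition_fun A eta (X p)))); first exact: cvg_cst.
apply: (@continuousB _ _ _ (fun=> ln m%:R)
  (fun p => ln (partition_fun A eta (X p)))); first exact: cvg_cst.
apply: (@continuous_comp _ _ _ (fun p => partition_fun A eta (X p)) (@ln R)).
  exact: partition_fun_continuous.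
by apply: continuous_ln; exact: partition_fun_gt0.
Qed.

Lemma payoff_continuous (Y : S -> 'cV[R]_m) :
  (forall j, continuous (fun p => Y p j 0)) ->
  continuous (fun p => payoff A (X p) (Y p)).
Proof.
move=> Yc; under eq_fun do rewrite payoff_sumE.
apply: continuous_sumr => j _; apply: continuous_sumr => i _ p.
apply: (@continuousM _ _ (fun p => X p i 0 * A i j) (fun p => Y p j 0)).
  apply: (@continuousM _ _ (fun p => X p i 0) (fun=> A i j)).
    exact: X_continuous.
  exact: cvg_cst.
exact: Yc.
Qed.

End EntrywiseContinuity.

(** * Continuous time: the utility of a strategy equals the potential of its cumulative play *)

Lemma ler_distl_sandwich (R : realDomainType) (u a b c k : R) :
  `|u - a| <= k -> `|u - b| <= k -> b <= c -> c <= a -> `|u - c| <= k.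
Proof.
by rewrite !ler_norml => /andP[h1 h2] /andP[h3 h4] h5 h6; apply/andP; split; lra.
Qed.

Lemma Rintegral_cst_itv (R : realType) (b : bool) (c s t : R) : s <= t ->
  Rintegral (@lebesgue_measure R) [set` Interval (BSide b s) (BRight t)] (fun=> c) =
  c * (t - s).
Proof.
move=> st; rewrite Rintegral_cst//= lebesgue_measure_itv/= lte_fin.
by case: ltP => // ts; rewrite (@le_anti _ _ s t) ?st// subrr.
Qed.

Section ContinuousTime.
Variables (R : realType) (n m : nat) (A : 'M[R]_(n, m)) (eta T : R).
Hypotheses (eta0 : 0 < eta) (T0 : 0 <= T).
Variable x : R -> 'cV[R]_n.
Hypothesis xS : cont_strategy T x.
Local Notation mu := (@lebesgue_measure R).

(** [replicator A eta x t] is by definition [exp_weights A eta (cum t)], so facts on exponential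
    weights transfer directly. *)
Let cum (t : R) : 'cV[R]_n := \col_i Rintegral mu `[0, t] (fun s => x s i 0).
(** A crude constant that bounds both the payoff against responses with entries in [0, 1] and the
    rate of change of [A^T *m cum t]. *)
Let B := \sum_j \sum_i `|A i j|.

Lemma bounded_integrable_ccitv (f : R -> R) (M : R) :
  measurable_fun `[0, T] f -> (forall t, 0 <= t <= T -> `|f t| <= M) ->
  mu.-integrable `[0, T] (EFin \o f).
Proof.
move=> mf fM; apply: measurable_bounded_integrable => //.
  exact: compact_finite_measure (@segment_compact _ _ _).
exists M; split; first exact: num_real.
move=> y My t /=; rewrite in_itv/= => /fM h; exact: le_trans h (ltW My).
Qed.

Let sub_ocitv s t : 0 <= s -> t <= T -> `]s, t]%classic `<=` `[0, T].
Proof.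
move=> s0 tT r /=; rewrite !in_itv/= => /andP[sr rt].
by rewrite (le_trans s0 (ltW sr)) (le_trans rt).
Qed.

Let integrable_ocitv f s t : 0 <= s -> t <= T ->
  mu.-integrable `[0, T] (EFin \o f) -> mu.-integrable `]s, t] (EFin \o f).
Proof. by move=> s0 tT; apply: integrableS => //; exact: sub_ocitv. Qed.

Let norm_entry_le1 t i : 0 <= t <= T -> `|x t i 0| <= 1.
Proof.
move=> /xS.2 /(simplex_ge0_le1 i) /andP[h0 h1]; by rewrite ger0_norm.
Qed.

Lemma entry_integrable i : mu.-integrable `[0, T] (EFin \o (fun t => x t i 0)).
Proof.
apply: (@bounded_integrable_ccitv _ 1); first exact: xS.1.
by move=> t; exact: norm_entry_le1.
Qed.

Lemma Rintegral_increment (f : R -> R) s t : 0 <= s -> s <= t -> t <= T ->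
    mu.-integrable `[0, T] (EFin \o f) ->
  Rintegral mu `[0, t] f - Rintegral mu `[0, s] f = Rintegral mu `]s, t] f.
Proof.
move=> s0 st tT fi; apply: Rintegral_itvB; rewrite ?bnd_simp//.
apply: integrableS fi => // r /=; rewrite !in_itv/= => /andP[-> rt].
exact: le_trans rt tT.
Qed.

Lemma cum_increment s t i : 0 <= s -> s <= t -> t <= T ->
  (cum t - cum s) i 0 = Rintegral mu `]s, t] (fun r => x r i 0).
Proof.
move=> s0 st tT; rewrite -Rintegral_increment//; last exact: entry_integrable.
by rewrite !mxE.
Qed.

Lemma Rintegral_norm_le (f : R -> R) M s t : 0 <= s -> s <= t -> t <= T ->
    mu.-integrable `[0, T] (EFin \o f) ->
    (forall r, s <= r <= t -> `|f r| <= M) ->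
  `|Rintegral mu `]s, t] f| <= M * (t - s).
Proof.
move=> s0 st tT fi fM; have fi' := integrable_ocitv s0 tT fi.
apply: (le_trans (le_normr_Rintegral _ fi')) => //.
have -> : M * (t - s) = Rintegral mu `]s, t] (fun=> M).
  by rewrite Rintegral_cst_itv.
apply: le_Rintegral => //.
- exact: integrable_norm.
- apply: integrable_ocitv => //; apply: (@bounded_integrable_ccitv _ `|M|) => //.
- by move=> r /=; rewrite in_itv/= => /andP[/ltW sr rt]; apply: fM; rewrite sr.
Qed.

(** With the response [y] frozen, the payoff is linear in the play and commutes with the
    integral. *)
Lemma payoff_increment s t y : 0 <= s -> s <= t -> t <= T ->
  payoff A (cum t - cum s) y = Rintegral mu `]s, t] (fun r => payoff A (x r) y).
Proof.
move=> s0 st tT.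
under eq_Rintegral do rewrite payoff_linearE.
rewrite payoff_linearE Rintegral_sum//.
  apply: eq_bigr => i _; rewrite cum_increment// RintegralZr//.
  by apply: integrable_ocitv => //; exact: entry_integrable.
move=> i; apply: integrable_ocitv => //.
apply: (@bounded_integrable_ccitv _ `|(A *m y) i 0|).
  by apply: measurable_funM => //; exact: xS.1.
by move=> r rT; rewrite normrM ler_piMl// norm_entry_le1.
Qed.

Let B_ge0 : 0 <= B.
Proof. by apply: sumr_ge0 => j _; apply: sumr_ge0. Qed.

Lemma norm_payoff_le t (y : 'cV[R]_m) d : 0 <= t <= T -> (forall j, `|y j 0| <= d) ->
  `|payoff A (x t) y| <= B * d.
Proof.
move=> tT yd; rewrite payoff_sumE /B mulr_suml.
apply: (le_trans (ler_norm_sum _ _ _)); apply: ler_sum => j _; rewrite mulr_suml.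
apply: (le_trans (ler_norm_sum _ _ _)); apply: ler_sum => i _.
rewrite !normrM ler_pM// ?mulr_ge0// ler_piMl//.
exact: norm_entry_le1.
Qed.

Lemma norm_cum_increment_le s t j : 0 <= s -> s <= t -> t <= T ->
  `|(A^T *m (cum t - cum s)) j 0| <= B * (t - s).
Proof.
move=> s0 st tT; rewrite mxE.
apply: (@le_trans _ _ ((\sum_i `|A i j|) * (t - s))).
  rewrite mulr_suml; apply: (le_trans (ler_norm_sum _ _ _)); apply: ler_sum => i _.
  rewrite normrM mxE ler_wpM2l// cum_increment//.
  rewrite -[leRHS]mul1r; apply: Rintegral_norm_le => //; first exact: entry_integrable.
  move=> r /andP[sr rt]; apply: norm_entry_le1.
  by rewrite (le_trans s0 sr) (le_trans rt tT).
rewrite ler_wpM2r ?subr_ge0// /B [leRHS](bigD1 j)//= lerDl.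
by apply: sumr_ge0 => k _; apply: sumr_ge0.
Qed.

Lemma replicator_lip s t j : 0 <= s -> s <= t -> t <= T ->
  `|replicator A eta x t j 0 - replicator A eta x s j 0| <= 2 * eta * (B * (t - s)).
Proof.
move=> s0 st tT.
have h1 : forall j, `|(A^T *m (cum t - cum s)) j 0| <= B * (t - s).
  by move=> k; exact: norm_cum_increment_le.
have h2 : forall j, `|(A^T *m (cum s - cum t)) j 0| <= B * (t - s).
  by move=> k; rewrite -[cum s - cum t]opprB mulmxN mxE normrN; exact: h1.
have e0 := ltW eta0.
rewrite ler_norml (exp_weights_lip e0 h2) andbT lerNl opprB.
exact: (exp_weights_lip e0 h1).
Qed.

Lemma cum_continuous i :
  {within `[0, T], continuous (fun t => cum t i 0)}.
Proof.
have -> : (fun t => cum t i 0) = (fun t => Rintegral mu `[0, t] (fun r => x r i 0)).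
  by apply: funext => t; rewrite mxE.
exact: parameterized_integral_continuous (entry_integrable i).
Qed.

(** The integrand is bounded by [B], and measurable because the response is continuous on [[0, T]],
    being a continuous function of an integral with varying endpoint. *)
Lemma utility_integrable :
  mu.-integrable `[0, T] (EFin \o (fun t => payoff A (x t) (replicator A eta x t))).
Proof.
apply: (@bounded_integrable_ccitv _ (B * 1)); last first.
  move=> t tT; apply: norm_payoff_le => // j.
  by rewrite ger0_norm ?exp_weights_ge0// exp_weights_le1.
rewrite (funext (fun t => payoff_sumE A (x t) (replicator A eta x t))).
apply: measurable_sum => j; apply: measurable_sum => i.
apply: measurable_funM.
  by apply: measurable_funM => //; exact: xS.1.
apply: subspace_continuous_measurable_fun => //.
exact: (@exp_weights_continuous (subspace `[0, T]) R n m A eta cum cum_continuous j).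
Qed.

(** Freezing the response at time [r] costs at most B (2 eta B) (t - s) at each instant, by the
    Lipschitz bound, and the interval has length t - s. The time [r] is left free so that both
    endpoints can be used. *)
Lemma utility_increment s t r : 0 <= s -> s <= r -> r <= t -> t <= T ->
  `|Rintegral mu `]s, t] (fun u => payoff A (x u) (replicator A eta x u)) -
    payoff A (cum t - cum s) (replicator A eta x r)|
  <= B * (2 * eta * B) * (t - s) ^+ 2.
Proof.
move=> s0 sr rt tT; have st := le_trans sr rt.
have ci : mu.-integrable `[0, T]
    (EFin \o (fun u => payoff A (x u) (replicator A eta x r))).
  apply: (@bounded_integrable_ccitv _ (B * 1)).
    rewrite (funext (fun u => payoff_linearE A (x u) (replicator A eta x r))).
    by apply: measurable_sum => i; apply: measurable_funM => //; exact: xS.1.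
  move=> u uT; apply: norm_payoff_le => // j.
  by rewrite ger0_norm ?exp_weights_ge0// exp_weights_le1.
have Ui := integrable_ocitv s0 tT utility_integrable.
have ci' := integrable_ocitv s0 tT ci.
rewrite (payoff_increment _ s0 st tT) -(RintegralB _ Ui ci'); last by [].
rewrite expr2 mulrA; apply: Rintegral_norm_le => //.
  exact: integrableB utility_integrable ci.
move=> u /andP[su ut]; rewrite -payoffBr -mulrA.
have uT : 0 <= u <= T by rewrite (le_trans s0 su) (le_trans ut tT).
apply: norm_payoff_le => // j.
rewrite mxE [X in _ + X]mxE -(mulrA (2 * eta)).
have c0 : 0 <= 2 * eta by rewrite mulr_ge0// ltW.
have [ur|/ltW ru] := leP u r.
  rewrite distrC (le_trans (replicator_lip _ _ ur _))//.
  - exact: le_trans s0 su.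
  - exact: le_trans rt tT.
  - by rewrite !ler_wpM2l// lerB.
rewrite (le_trans (replicator_lip _ _ ru _))//.
- exact: le_trans s0 sr.
- exact: le_trans ut tT.
- by rewrite !ler_wpM2l// lerB.
Qed.

Lemma cum0 : cum 0 = 0.
Proof. by apply/colP => i; rewrite !mxE set_itv1 Rintegral_set1. Qed.

Lemma cont_utilityE : cont_utility A eta T x = potential A eta (cum T).
Proof.
pose G t := Rintegral mu `[0, t] (fun u => payoff A (x u) (replicator A eta x u)) -
  potential A eta (cum t).
suff : G T = G 0.
  rewrite /G cum0 potential0 set_itv1 Rintegral_set1 subr0 => /eqP.
  by rewrite subr_eq0 => /eqP.
apply: (@quadratic_increments_constant _ _ (B * (2 * eta * B))) => // s t s0 st tT.
have -> : G t - G s =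
    Rintegral mu `]s, t] (fun u => payoff A (x u) (replicator A eta x u)) -
    (potential A eta (cum t) - potential A eta (cum s)).
  have swap (a b c d : R) : a - c - (b - d) = (a - b) - (c - d) by ring.
  by rewrite -(Rintegral_increment s0 st tT utility_integrable) /G swap.
have hs := utility_increment s0 (lexx s) st tT.
have ht := utility_increment s0 st (lexx t) tT.
have ps := potential_step A (cum s) (cum t - cum s) eta0.
(* The step taken backwards from [cum t]: after negation it bounds the potential increment from
   below, while [ps] bounds it from above. *)
have pt := potential_step A (cum t) (cum s - cum t) eta0.
rewrite [cum s + _]addrC subrK in ps; rewrite [cum t + _]addrC subrK in pt.
rewrite -[cum s - cum t]opprB payoffNl in pt.
rewrite lerNr opprB in pt.
exact: ler_distl_sandwich hs ht pt ps.
Qed.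

(** The witness is the time average of the play. As the utility depends on [cum T] alone, playing
    this average throughout earns the same. *)
Lemma cum_simplex : exists2 z, simplex z & cum T = T *: z.
Proof.
have [T00|Tn0] := eqVneq T 0.
  (* For [T = 0] there is no average, and any point of the simplex will do. *)
  exists (x 0); first by apply: xS.2; rewrite lexx.
  by rewrite T00 scale0r cum0.
exists (T^-1 *: cum T); last by rewrite scalerA mulfV// scale1r.
split=> [i|].
  rewrite !mxE mulr_ge0 ?invr_ge0//; apply: Rintegral_ge0 => t /=.
  by rewrite in_itv/= => /xS.2 [].
under eq_bigr do rewrite !mxE.
rewrite -mulr_sumr -Rintegral_sum//; last by move=> i; exact: entry_integrable.
have -> : Rintegral mu `[0, T] (fun t => \sum_i x t i 0) = Rintegral mu `[0, T] (fun=> 1).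
  by apply: eq_Rintegral => t /set_mem /=; rewrite in_itv/= => /xS.2 [].
by rewrite Rintegral_cst_itv// mul1r subr0 mulVf.
Qed.

End ContinuousTime.

(** * Constant strategies, existence of the maxima, and the comparison *)

Lemma cont_strategy_cst (R : realType) (n : nat) (T : R) (x : 'cV[R]_n) :
  simplex x -> cont_strategy T (fun=> x).
Proof. by move=> xS; split=> // i; exact: measurable_cst. Qed.

Lemma cont_utility_cst (R : realType) (n m : nat) (A : 'M[R]_(n, m)) (eta T : R)
    (x : 'cV[R]_n) : 0 < eta -> 0 <= T -> simplex x ->
  cont_utility A eta T (fun=> x) = const_objective A eta T x.
Proof.
move=> eta0 T0 xS; rewrite (cont_utilityE A eta0 T0 (cont_strategy_cst T xS)).
rewrite const_objectiveE; congr potential; apply/colP => i.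
by rewrite !mxE Rintegral_cst_itv// subr0 mulrC.
Qed.

(** Allows plays outside rounds 1, ..., T to be overwritten, since the compactness argument wants
    simplex points at every index. *)
Lemma disc_utility_eq_in (R : realType) (n m : nat) (A : 'M[R]_(n, m)) (eta : R)
    (T : nat) (x x' : nat -> 'cV[R]_n) :
  (forall t, (1 <= t <= T)%N -> x t = x' t) ->
  disc_utility A eta T x = disc_utility A eta T x'.
Proof.
move=> xx'; apply: eq_big_nat => t /andP[t1 tT].
rewrite xx' ?t1// /mwu; congr (payoff _ _ (exp_weights _ _ _)).
apply: eq_big_nat => s /andP[s1 st]; apply: xx'.
by rewrite s1 (leq_trans (ltnW st)).
Qed.

Lemma optimal_const_exists (R : realType) (n m : nat) (A : 'M[R]_(n, m)) (eta T : R) :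
  (0 < n)%N -> exists x, optimal_const A eta T x.
Proof.
move=> n0.
have [|x xS xmax] :=
    @simplex_sequences_max R n (fun x => const_objective A eta T (x 0%N)) n0.
  (* Scaling by [T] is written as a matrix product to fit [mulmx_entry_continuous]; the vector sits
     at index 0 of a sequence. *)
  have objE (z : 'cV[R]_n) : const_objective A eta T z = potential A eta (T%:M *m z).
    by rewrite const_objectiveE mul_scalar_mx.
  rewrite (funext (fun f : sequence_space R n => objE (\col_i f (0%N, i)))).
  apply: potential_continuous; apply: mulmx_entry_continuous => i.
  exact: sequence_space_entry_continuous.
exists (x 0%N); split=> // z zS; exact: (xmax (fun=> z)).
Qed.

Lemma R_disc_exists (R : realType) (n m : nat) (A : 'M[R]_(n, m)) (eta : R) (T : nat) :
  (0 < n)%N -> exists v, is_R_disc A eta T v.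
Proof.
move=> n0; have [|x xS xmax] := @simplex_sequences_max R n (disc_utility A eta T) n0.
  apply: continuous_sumr => t _; apply: payoff_continuous => [i|].
    exact: sequence_space_entry_continuous.
  apply: exp_weights_continuous => i.
  rewrite (funext (fun f : sequence_space R n => summxE _ _ _ i 0)).
  by apply: continuous_sumr => s _; exact: sequence_space_entry_continuous.
exists (disc_utility A eta T x); split; first by exists x.
move=> _ [z zS <-].
(* [x0] fills the indices that [disc_strategy] leaves unconstrained. *)
have [x0 x0S] := simplex_nonempty R n0.
rewrite (@disc_utility_eq_in _ _ _ _ _ _ _
  (fun t => if (1 <= t <= T)%N then z t else x0)); last by move=> t ->.
by apply: xmax => t; case: ifP => // /zS.
Qed.

Theorem proposition8 (R : realType) (n m : nat) (A : 'M[R]_(n, m))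
    (eta : R) (T : nat) :
  (0 < n)%N -> 0 < eta ->
  exists Rcont Rdisc : R,
    [/\ is_R_cont A eta T%:R Rcont,
        is_R_disc A eta T Rdisc,
        forall xstar : 'cV[R]_n, optimal_const A eta T%:R xstar ->
          Rcont <= disc_utility A eta T (fun=> xstar)
      & Rcont <= Rdisc].
Proof.
move=> n0 eta0; have T0 : 0 <= T%:R :> R by [].
have [x [xS xmax]] := optimal_const_exists A eta T%:R n0.
have [v vmax] := R_disc_exists A eta T n0.
have le_disc z : optimal_const A eta T%:R z ->
    const_objective A eta T%:R x <= disc_utility A eta T (fun=> z).
  by move=> [_ zmax]; apply: le_trans (zmax _ xS) (disc_utility_const_ge _ _ _ eta0).
exists (const_objective A eta T%:R x), v; split=> //.
- split=> [|_ [z zS <-]].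
    exists (fun=> x); first exact: cont_strategy_cst.
    exact: cont_utility_cst.
  rewrite (cont_utilityE A eta0 T0 zS).
  (* The utility of [z] is the objective at its time average [w], hence at most the objective at
     [x]. *)
  have [w wS ->] := cum_simplex T0 zS.
  by rewrite -const_objectiveE; exact: xmax.
- apply: le_trans (le_disc x (conj xS xmax)) _.
  by apply: vmax.2; exists (fun=> x).
Qed.
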